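(* For all integers $k,n\ge 1$, \begin{align*} \zeta^*(k+1,\underbrace{1,\dots,1}_{n})&=(-1)^{k-1}\Big[\sum_{j=0}^{k-2}\zeta(n+1,\underbrace{1,\dots,1}_{j},2,\underbrace{1,\dots,1}_{k-2-j})+(n+1)\,\zeta(n+2,\underbrace{1,\dots,1}_{k-1})\Big]\\ &\quad+\sum_{r=0}^{k-2}(-1)^r\zeta(k-r)\,\zeta(n+1,\underbrace{1,\dots,1}_{r}), \end{align*} where an empty sum equals $0$.
   Context: For positive integers $k_1,\dots,k_n$ with $k_1\ge 2$, $\zeta(k_1,\dots,k_n)=\sum_{m_1>\dots>m_n\ge 1}\prod_i m_i^{-k_i}$ and $\zeta^*(k_1,\dots,k_n)=\sum_{m_1\ge\dots\ge m_n\ge 1}\prod_i m_i^{-k_i}$. $\underbrace{1,\dots,1}_{r}$ denotes $r$ entries equal to $1$ (none if $r=0$). *)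

(* Defs.v *)
From Stdlib Require Import Reals List.
From Coquelicot Require Import Coquelicot.
Open Scope R_scope.

(* Truncated multiple zeta sum:
   zeta_trunc N [k1;...;kn] = sum_{N >= m1 > m2 > ... > mn >= 1} prod m_i^{-k_i}. *)
Fixpoint zeta_trunc (N : nat) (ks : list nat) {struct ks} : R :=
  match ks with
  | nil => 1
  | k :: ks' =>
      (fix outer (M : nat) : R :=
         match M with
         | O => 0
         | S m => outer m + / (INR (S m)) ^ k * zeta_trunc m ks'
         end) N
  end.

(* Truncated multiple zeta-star sum:
   zetastar_trunc N [k1;...;kn] = sum_{N >= m1 >= m2 >= ... >= mn >= 1} prod m_i^{-k_i}. *)
Fixpoint zetastar_trunc (N : nat) (ks : list nat) {struct ks} : R :=
  match ks with
  | nil => 1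
  | k :: ks' =>
      (fix outer (M : nat) : R :=
         match M with
         | O => 0
         | S m => outer m + / (INR (S m)) ^ k * zetastar_trunc (S m) ks'
         end) N
  end.

(* The multiple zeta value: the sum of the (nonnegative) series, i.e. the limit
   of the truncated sums as the cutoff N -> oo (finite when k1 >= 2). *)
Definition mzv (ks : list nat) : R := real (Lim_seq (fun N => zeta_trunc N ks)).
Definition mzsv (ks : list nat) : R := real (Lim_seq (fun N => zetastar_trunc N ks)).

Fixpoint sum_lt (n : nat) (f : nat -> R) : R :=
  match n with
  | O => 0
  | S m => sum_lt m f + f m
  end.

Definition ones (r : nat) : list nat := repeat 1%nat r.

(* Main.v *)
Require Import Defs.
From Stdlib Require Import Reals List.
From Coquelicot Require Import Coquelicot.
From Stdlib Require Import Factorial Lra Lia.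
Open Scope R_scope.

(** Write [e_r(m)] for the elementary symmetric sum of [1/1, ..., 1/(m-1)] and [H_m] for the harmonic
    number. Since [sum_m e_(n-1)(m) / (m (l+m))] telescopes to the star sum of [n] ones up to [l],
    divided by [l], the left side is the double series of [e_(n-1)(m) / (l^k m (l+m))]. Summing over
    [l] first and using partial fractions [1/(l (l+m)) = (1/m) (1/l - 1/(l+m))] repeatedly gives
    the products [zeta(k-r) zeta(r+2, 1^(n-1))] and the remainder
    [(-1)^(k-1) sum_m e_(n-1)(m) H_m / m^(k+1)].

    Both are rewritten with the connector [C(m,p) = m! p! / (m+p)!] of Seki and Yamamoto: the
    identity [sum_p e_r(p) C(m,p) / p = 1 / m^(r+1)] and its symmetric form give the duality
    [zeta(r+2, 1^(n-1)) = zeta(n+1, 1^r)], and the derivatives of these identities in [p] turn the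
    remainder into the bracket of the theorem. All interchanges involve nonnegative terms. *)

(* Coquelicot's sums produce equations in the carrier of [R_AbelianMonoid], which [ring] does not unfold. *)
Ltac eq_R := match goal with |- @eq _ ?x ?y => change (@eq R x y) end.
Ltac ring_R := eq_R; ring.

(** * Series of reals: interchange of summation and summation by parts *)

Lemma sum_n_Sn_R (a : nat -> R) (n : nat) : sum_n a (S n) = sum_n a n + a (S n).
Proof. exact (sum_Sn a n). Qed.

Lemma sum_n_0_R (a : nat -> R) : sum_n a 0 = a 0%nat.
Proof. exact (sum_O a). Qed.

Lemma sum_n_incr (a : nat -> R) (n : nat) :
  (forall i, 0 <= a i) -> sum_n a n <= sum_n a (S n).
Proof. intros Ha. rewrite sum_n_Sn_R. specialize (Ha (S n)). lra. Qed.

Lemma sum_n_nonneg (a : nat -> R) (n : nat) : (forall i, 0 <= a i) -> 0 <= sum_n a n.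
Proof.
  intros Ha. induction n as [|n IH].
  - rewrite sum_n_0_R. apply Ha.
  - pose proof (sum_n_incr a n Ha). lra.
Qed.

Lemma is_series_lim (a : nat -> R) (s : R) : is_series a s <-> is_lim_seq (sum_n a) s.
Proof. split; intros H; exact H. Qed.

Lemma sum_n_le_series (a : nat -> R) (s : R) (n : nat) :
  (forall i, 0 <= a i) -> is_series a s -> sum_n a n <= s.
Proof.
  intros Ha Hs. apply (is_lim_seq_incr_compare (sum_n a) s Hs).
  intros k. now apply sum_n_incr.
Qed.

Lemma is_series_scal_R (c : R) (a : nat -> R) (s : R) :
  is_series a s -> is_series (fun i => c * a i) (c * s).
Proof. exact (is_series_scal_l c a s). Qed.

Lemma is_series_plus_R (a b : nat -> R) (s t : R) :
  is_series a s -> is_series b t -> is_series (fun i => a i + b i) (s + t).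
Proof. exact (is_series_plus a b s t). Qed.

Lemma is_series_eq (a b : nat -> R) (s t : R) :
  is_series a s -> (forall i, a i = b i) -> s = t -> is_series b t.
Proof. intros H Hab <-. exact (is_series_ext a b s Hab H). Qed.

Lemma ex_series_le_R (a b : nat -> R) :
  (forall i, 0 <= a i <= b i) -> ex_series b -> ex_series a.
Proof.
  intros H. apply (ex_series_le a b). intros i. destruct (H i).
  change (Rabs (a i) <= b i). rewrite Rabs_pos_eq; lra.
Qed.

Lemma is_series_zero : is_series (fun _ : nat => 0) 0.
Proof.
  apply is_series_lim.
  apply (is_lim_seq_ext (fun _ => 0)); [|apply is_lim_seq_const].
  intros n. rewrite sum_n_const. ring.
Qed.

Lemma sum_n_is_series (f : nat -> nat -> R) (b : nat -> R) (n : nat) :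
  (forall j, is_series (fun i => f i j) (b j)) ->
  is_series (fun i => sum_n (f i) n) (sum_n b n).
Proof.
  intros Hb. induction n as [|n IH].
  - rewrite sum_n_0_R. apply (is_series_ext (fun i => f i 0%nat)); [|apply Hb].
    intros i. now rewrite sum_n_0_R.
  - rewrite sum_n_Sn_R. eapply is_series_eq; [|intros i; symmetry; apply sum_n_Sn_R|reflexivity].
    now apply (is_series_plus_R _ (fun i => f i (S n))).
Qed.

(** A finite sum of columns is the series of the partial row sums, each at most the full row sum. So
    the partial sums of [b] are bounded by [s], and being increasing they converge. *)
Lemma tonelli_le (f : nat -> nat -> R) (a b : nat -> R) (s : R) :
  (forall i j, 0 <= f i j) ->
  (forall i, is_series (f i) (a i)) -> is_series a s ->
  (forall j, is_series (fun i => f i j) (b j)) ->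
  exists t, t <= s /\ is_series b t.
Proof.
  intros Hf Ha Hs Hb.
  assert (Hb0 : forall j, 0 <= b j).
  { intros j. eapply Rle_trans; [|apply (sum_n_le_series _ _ 0 (fun i => Hf i j) (Hb j))].
    apply sum_n_nonneg. intros i; apply Hf. }
  assert (Hle : forall n, sum_n b n <= s).
  { intros n. pose proof (sum_n_is_series f b n Hb) as H.
    assert (HN : forall N, sum_n (fun i => sum_n (f i) n) N <= sum_n a N).
    { intros N. apply sum_n_m_le. intros i. apply sum_n_le_series; auto. }
    exact (is_lim_seq_le _ _ (sum_n b n) s HN H Hs). }
  destruct (ex_finite_lim_seq_incr (sum_n b) s) as [t Ht]; auto.
  { intros n. now apply sum_n_incr. }
  exists t. split; [|exact Ht].
  exact (is_lim_seq_le _ _ t s Hle Ht (is_lim_seq_const s)).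
Qed.

(** The one-sided bound is applied twice, the second time with rows and columns exchanged, so the
    two totals bound each other. *)
Lemma tonelli (f : nat -> nat -> R) (a b : nat -> R) (s : R) :
  (forall i j, 0 <= f i j) ->
  (forall i, is_series (f i) (a i)) -> is_series a s ->
  (forall j, is_series (fun i => f i j) (b j)) ->
  is_series b s.
Proof.
  intros Hf Ha Hs Hb.
  destruct (tonelli_le f a b s Hf Ha Hs Hb) as (t & Hts & Ht).
  destruct (tonelli_le (fun j i => f i j) b a t) as (s' & Hs't & Hs'); auto.
  apply is_series_unique in Hs. apply is_series_unique in Hs'.
  now replace s with t by lra.
Qed.

(** Summation by parts. No growth bound on [G] is assumed: convergence of the series of
    [g i * f (S i)], with [f] decreasing to 0, already forces the boundary term [G (S N) * f (S N)]
    to 0. *)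
Lemma abel_summation (f g G : nat -> R) (s : R) :
  (forall i, f (S i) <= f i) -> is_lim_seq f 0 ->
  (forall i, 0 <= g i) -> (forall i, G (S i) = G i + g i) ->
  is_series (fun i => g i * f (S i)) s ->
  is_series (fun i => G i * (f i - f (S i))) (G 0%nat * f 0%nat + s).
Proof.
  intros Hdec Hlim Hg HG Hs.
  assert (Hf0 : forall i, 0 <= f i).
  { intros i. exact (is_lim_seq_decr_compare f 0 Hlim Hdec i). }
  assert (Hpart : forall N, sum_n (fun i => G i * (f i - f (S i))) N =
     G 0%nat * f 0%nat + sum_n (fun i => g i * f (S i)) N - G (S N) * f (S N)).
  { induction N as [|N IH].
    - rewrite !sum_n_0_R, HG. ring_R.
    - rewrite !sum_n_Sn_R, IH, (HG (S N)). ring_R. }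
  set (A := sum_n (fun i => g i * f (S i))) in *.
  assert (HA : is_lim_seq A s) by exact Hs.
  (* Splitting at a fixed P: the mass after P is controlled by the tail of [A]. *)
  assert (Hbound : forall P d,
     (G (S (P + d)) - G (S P)) * f (S (P + d)) <= A (P + d)%nat - A P).
  { intros P d. induction d as [|d IH].
    - rewrite Nat.add_0_r. lra.
    - rewrite Nat.add_succ_r, HG. unfold A at 1. rewrite sum_n_Sn_R. fold A.
      assert (0 <= G (S (P + d)) - G (S P)).
      { clear - HG Hg. induction d as [|d IH]; [rewrite Nat.add_0_r; lra|].
        rewrite Nat.add_succ_r, HG. specialize (Hg (S (P+d))). lra. }
      specialize (Hdec (S (P + d))). nra. }
  (* [P] makes the tail of [A] small, which controls the growth of [G] after [P]; the growth up to
     [P] is a constant times [f], small beyond [Q]. Subtracting [G 0] keeps the quantity nonnegative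
     whatever the sign of [G 0]. *)
  assert (Hrem : is_lim_seq (fun N => (G (S N) - G 0%nat) * f (S N)) 0).
  { apply is_lim_seq_spec. intros eps.
    assert (Heps : 0 < eps / 2) by (destruct eps; simpl; lra).
    apply is_lim_seq_spec in HA.
    destruct (HA (mkposreal _ Heps)) as [P HP]. simpl in HP.
    assert (HC : is_lim_seq (fun N => (G (S P) - G 0%nat) * f N) 0).
    { replace (Finite 0) with (Rbar_mult (G (S P) - G 0%nat) 0)
        by (simpl; f_equal; ring).
      now apply is_lim_seq_scal_l. }
    apply is_lim_seq_spec in HC.
    destruct (HC (mkposreal _ Heps)) as [Q HQ]. simpl in HQ.
    exists (P + Q)%nat. intros N HN.
    assert (HG0 : forall i, 0 <= G i - G 0%nat).
    { intros i. induction i as [|i IH]; [lra|]. rewrite HG. specialize (Hg i). lra. }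
    rewrite Rminus_0_r, Rabs_pos_eq by (apply Rmult_le_pos; auto).
    specialize (HQ (S N) ltac:(lia)). rewrite Rminus_0_r in HQ.
    apply Rabs_def2 in HQ.
    assert (HAs : A N <= s).
    { apply sum_n_le_series; auto. intros i. apply Rmult_le_pos; auto. }
    specialize (HP P (le_n _)). apply Rabs_def2 in HP.
    specialize (Hbound P (N - P)%nat).
    replace (P + (N - P))%nat with N in Hbound by lia. lra. }
  apply is_series_lim.
  apply (is_lim_seq_ext (fun N => (G 0%nat * f 0%nat + A N)
           + - ((G (S N) - G 0%nat) * f (S N) + G 0%nat * f (S N)))).
  { intros N. rewrite Hpart. ring. }
  replace (G 0%nat * f 0%nat + s) with ((G 0%nat * f 0%nat + s) + - (0 + G 0%nat * 0)) by ring.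
  apply is_lim_seq_plus'.
  - apply is_lim_seq_plus'; [apply is_lim_seq_const|exact HA].
  - change (Finite (- (0 + G 0%nat * 0))) with (Rbar_opp (0 + G 0%nat * 0)).
    apply -> is_lim_seq_opp. apply is_lim_seq_plus'; [exact Hrem|].
    apply (is_lim_seq_scal_l (fun N => f (S N)) (G 0%nat) 0).
    now apply (is_lim_seq_incr_1 f 0).
Qed.

Lemma is_lim_seq_inv_shift (c : R) : is_lim_seq (fun i => / (INR i + c)) 0.
Proof.
  change (Finite 0) with (Rbar_inv p_infty).
  apply is_lim_seq_inv; [|discriminate].
  apply (is_lim_seq_plus INR (fun _ => c) p_infty c p_infty).
  - apply is_lim_seq_INR.
  - apply is_lim_seq_const.
  - reflexivity.
Qed.

(** * Truncated sums, their recurrences and their limits *)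

Lemma INR_S_pos (n : nat) : 0 < INR (S n).
Proof. apply lt_0_INR. lia. Qed.

Lemma inv_pow_pos (n k : nat) : 0 < / INR (S n) ^ k.
Proof. apply Rinv_0_lt_compat, pow_lt, INR_S_pos. Qed.

Lemma zeta_trunc_S (N k : nat) (ks : list nat) :
  zeta_trunc (S N) (k :: ks) = zeta_trunc N (k :: ks) + / INR (S N) ^ k * zeta_trunc N ks.
Proof. reflexivity. Qed.

Lemma zetastar_trunc_S (N k : nat) (ks : list nat) :
  zetastar_trunc (S N) (k :: ks) =
  zetastar_trunc N (k :: ks) + / INR (S N) ^ k * zetastar_trunc (S N) ks.
Proof. reflexivity. Qed.

Lemma zeta_trunc_nonneg (ks : list nat) (N : nat) : 0 <= zeta_trunc N ks.
Proof.
  revert N. induction ks as [|k ks IH]; intros N; [simpl; lra|].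
  induction N as [|N IHN]; [simpl; lra|].
  rewrite zeta_trunc_S. pose proof (inv_pow_pos N k). specialize (IH N). nra.
Qed.

(** [mzv] passes a limit through [real], so its value is read off only once convergence is known;
    the proofs therefore work with [is_series]. Term [i] stands for [m_1 = i + 1], and the strict
    inequality leaves the cutoff [i] for the remaining indices. *)
Lemma is_series_mzv (k : nat) (ks : list nat) (s : R) :
  is_series (fun i => / INR (S i) ^ k * zeta_trunc i ks) s -> mzv (k :: ks) = s.
Proof.
  intros H. unfold mzv. rewrite (is_lim_seq_unique _ s); [reflexivity|].
  apply is_lim_seq_incr_1. apply (proj1 (is_series_lim _ _)) in H.
  refine (is_lim_seq_ext _ _ s _ H). intros n. induction n as [|n IH].
  - rewrite sum_n_0_R, zeta_trunc_S. simpl. ring_R.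
  - now rewrite sum_n_Sn_R, zeta_trunc_S, IH.
Qed.

Lemma is_series_mzsv (k : nat) (ks : list nat) (s : R) :
  is_series (fun i => / INR (S i) ^ k * zetastar_trunc (S i) ks) s -> mzsv (k :: ks) = s.
Proof.
  intros H. unfold mzsv. rewrite (is_lim_seq_unique _ s); [reflexivity|].
  apply is_lim_seq_incr_1. apply (proj1 (is_series_lim _ _)) in H.
  refine (is_lim_seq_ext _ _ s _ H). intros n. induction n as [|n IH].
  - rewrite sum_n_0_R, zetastar_trunc_S. simpl. ring_R.
  - now rewrite sum_n_Sn_R, zetastar_trunc_S, IH.
Qed.

(* Series are indexed from [0], so [e_r(m)] is [esum r i] with [m = i + 1]. *)
Notation esum r i := (zeta_trunc i (ones r)).
Notation hsum r i := (zetastar_trunc i (ones r)).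
Notation harm i := (zeta_trunc i (ones 1)).

Lemma esum_S (r i : nat) : esum (S r) (S i) = esum (S r) i + esum r i / INR (S i).
Proof. change (ones (S r)) with (1%nat :: ones r). rewrite zeta_trunc_S, pow_1. unfold Rdiv. ring. Qed.

Lemma hsum_S (r i : nat) : hsum (S r) (S i) = hsum (S r) i + hsum r (S i) / INR (S i).
Proof. change (ones (S r)) with (1%nat :: ones r). rewrite zetastar_trunc_S, pow_1. unfold Rdiv. ring. Qed.

Lemma harm_S (i : nat) : harm (S i) = harm i + / INR (S i).
Proof. rewrite esum_S. simpl. unfold Rdiv. ring. Qed.

Lemma esum_div_nonneg (r i : nat) : 0 <= esum r i / INR (S i).
Proof. apply Rdiv_le_0_compat; [apply zeta_trunc_nonneg|apply INR_S_pos]. Qed.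

(** A plain telescoping sum, since [esum 0] is constantly 1; in this shape it starts the inductions
    on [r]. *)
Lemma abel_esum_0 (f : nat -> R) :
  (forall i, f (S i) <= f i) -> is_lim_seq f 0 ->
  is_series (fun i => esum 0 i * (f i - f (S i))) (f 0%nat).
Proof.
  intros Hdec Hlim.
  eapply is_series_eq; [apply (abel_summation f (fun _ => 0) (fun _ => 1) 0)|reflexivity|ring]; auto;
    try (intros; lra).
  apply (is_series_ext (fun _ => 0)); [intros; ring_R|apply is_series_zero].
Qed.

(** The step of the inductions on [r]: it lowers the depth by one at the price of a factor
    [1 / (i + 1)]. The boundary term vanishes because [esum (S r) 0] is 0. *)
Lemma abel_esum_S (r : nat) (f : nat -> R) (s : R) :
  (forall i, f (S i) <= f i) -> is_lim_seq f 0 ->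
  is_series (fun i => esum r i / INR (S i) * f (S i)) s ->
  is_series (fun i => esum (S r) i * (f i - f (S i))) s.
Proof.
  intros Hdec Hlim Hs.
  eapply is_series_eq;
    [apply (abel_summation f (fun i => esum r i / INR (S i)) (fun i => esum (S r) i) s)
    |reflexivity|simpl; ring]; auto.
  - intros i. apply esum_div_nonneg.
  - intros i. apply esum_S.
Qed.

(** * Star sums as single series *)

(** Passing from [l] to [S l] adds the series of [esum r i * (f i - f (S i))] with
    [f i = 1 / (i + l + 1)]. Summation by parts lowers [r], and partial fractions turn the result
    into [1 / (l + 1)] times the same series for [r - 1] at [S l], which is the increment in
    [hsum_S]. *)
Lemma is_series_hsum (r l : nat) :
  is_series (fun i => esum r i * (/ INR (S i) - / (INR (S i) + INR l))) (hsum (S r) l).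
Proof.
  revert l. induction r as [|r IH]; intros l; induction l as [|l IHl].
  1, 3: eapply is_series_eq; [apply is_series_zero|intros i; simpl (INR 0); rewrite Rplus_0_r; ring_R
        |reflexivity].
  all: pose (f := fun i => / (INR i + INR (S l)));
    assert (Hf : forall i, f (S i) <= f i) by
     (intros i; unfold f; pose proof (pos_INR i); pose proof (INR_S_pos l);
      rewrite S_INR; apply Rinv_le_contravar; lra);
    assert (Hlim : is_lim_seq f 0) by apply is_lim_seq_inv_shift;
    assert (Hd : forall i, f i = / (INR (S i) + INR l)) by
      (intros i; unfold f; f_equal; rewrite !S_INR; ring);
    rewrite hsum_S.
  - eapply is_series_eq.
    + apply (is_series_plus_R _ _ _ _ IHl (abel_esum_0 f Hf Hlim)).
    + intros i. cbv beta. rewrite Hd. unfold f. ring_R.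
    + unfold f. simpl (INR 0). simpl (hsum 0 _). rewrite Rplus_0_l. unfold Rdiv. ring.
  - eapply is_series_eq.
    + apply (is_series_plus_R _ (fun i => esum (S r) i * (f i - f (S i))) _
        (hsum (S r) (S l) / INR (S l)) IHl).
      apply (abel_esum_S r f _ Hf Hlim).
      eapply is_series_eq; [apply (is_series_scal_R (/ INR (S l)) _ _ (IH (S l)))| |unfold Rdiv; ring].
      intros i. unfold f. pose proof (INR_S_pos i). pose proof (INR_S_pos l).
      change (/ INR (S l) * (esum r i * (/ INR (S i) - / (INR (S i) + INR (S l)))) =
        esum r i / INR (S i) * / (INR (S i) + INR (S l))).
      field. repeat split; lra.
    + intros i. cbv beta. rewrite Hd. unfold f. ring_R.
    + reflexivity.
Qed.

(** The majorant comes from [1 / m^2 <= 2 * (1 / m - 1 / (m + 1))]; its sum is the case [l = 1] of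
    [is_series_hsum]. *)
Lemma ex_series_esum (r s : nat) : ex_series (fun i => / INR (S i) ^ (s + 2) * esum r i).
Proof.
  apply (ex_series_le_R _ (fun i => 2 * (esum r i * (/ INR (S i) - / (INR (S i) + INR 1))))).
  - intros i. pose proof (zeta_trunc_nonneg (ones r) i). pose proof (inv_pow_pos i (s + 2)).
    pose proof (INR_S_pos i) as Hi. split; [nra|].
    replace (2 * (esum r i * (/ INR (S i) - / (INR (S i) + INR 1)))) with
      (2 * (/ INR (S i) - / (INR (S i) + INR 1)) * esum r i) by ring.
    apply Rmult_le_compat_r; [assumption|].
    assert (H1 : 1 <= INR (S i)) by (rewrite S_INR; pose proof (pos_INR i); lra).
    apply Rle_trans with (/ INR (S i) ^ 2).
    + apply Rinv_le_contravar; [nra|]. apply Rle_pow; [assumption|lia].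
    + simpl (INR 1). generalize dependent (INR (S i)). intros x _ Hx H1.
      replace (2 * (/ x - / (x + 1))) with (/ (x * (x + 1) / 2)) by (field; lra).
      apply Rinv_le_contravar; nra.
  - exists (2 * hsum (S r) 1). apply is_series_scal_R, is_series_hsum.
Qed.

Lemma is_series_mzv_dominated (s r : nat) (ks : list nat) :
  (2 <= s)%nat -> (forall i, zeta_trunc i ks <= esum r i) ->
  is_series (fun i => / INR (S i) ^ s * zeta_trunc i ks) (mzv (s :: ks)).
Proof.
  intros Hs Hks.
  destruct (ex_series_le_R (fun i => / INR (S i) ^ s * zeta_trunc i ks)
     (fun i => / INR (S i) ^ s * esum r i)) as [t Ht].
  - intros i. pose proof (inv_pow_pos i s). pose proof (zeta_trunc_nonneg ks i).
    specialize (Hks i). split; [nra|]. apply Rmult_le_compat_l; lra.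
  - replace s with (s - 2 + 2)%nat by lia. apply ex_series_esum.
  - now rewrite (is_series_mzv _ _ _ Ht).
Qed.

Lemma is_series_mzv_ones (s r : nat) : (2 <= s)%nat ->
  is_series (fun i => / INR (S i) ^ s * esum r i) (mzv (s :: ones r)).
Proof. intros Hs. apply (is_series_mzv_dominated s r); [assumption|intros; lra]. Qed.

(** * The connector and its logarithmic derivative *)

(** The reciprocal of the binomial coefficient of [m + p] over [p]. *)
Definition conn (m p : nat) : R := INR (fact m) * INR (fact p) / INR (fact (m + p)).

(* Minus the derivative of [conn m p] in [p], once [conn] is extended to real [p] by the Gamma function. *)
Definition dconn (m p : nat) : R := conn m p * (harm (m + p) - harm p).

Lemma conn_sym (m p : nat) : conn m p = conn p m.
Proof. unfold conn. now rewrite (Nat.add_comm p m), (Rmult_comm (INR (fact p))). Qed.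

Lemma conn_pos (m p : nat) : 0 < conn m p.
Proof.
  unfold conn. apply Rdiv_lt_0_compat; [apply Rmult_lt_0_compat|]; apply INR_fact_lt_0.
Qed.

Lemma conn_0_r (m : nat) : conn m 0 = 1.
Proof.
  unfold conn. rewrite Nat.add_0_r. simpl (fact 0). simpl (INR 1).
  field. apply INR_fact_neq_0.
Qed.

Lemma conn_S_r (m p : nat) : conn m p = conn m (S p) * (INR m + INR (S p)) / INR (S p).
Proof.
  unfold conn. rewrite Nat.add_succ_r, !fact_simpl, !mult_INR, <- plus_INR, Nat.add_succ_r.
  field. repeat split; try apply INR_fact_neq_0; apply not_0_INR; lia.
Qed.

Lemma conn_sub_r (m p : nat) :
  conn m p - conn m (S p) = INR m * (conn m (S p) / INR (S p)).
Proof. rewrite (conn_S_r m p). field. apply not_0_INR; lia. Qed.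

Lemma conn_sub_l (m p : nat) :
  conn m p - conn (S m) p = INR p * (conn (S m) p / INR (S m)).
Proof. rewrite (conn_sym m), (conn_sym (S m)). apply conn_sub_r. Qed.

Lemma conn_decr_r (m p : nat) : conn m (S p) <= conn m p.
Proof.
  pose proof (conn_sub_r m p).
  assert (0 <= INR m * (conn m (S p) / INR (S p))); [|lra].
  apply Rmult_le_pos; [apply pos_INR|].
  apply Rdiv_le_0_compat; [apply Rlt_le, conn_pos|apply INR_S_pos].
Qed.

(** Equality holds at [m = 0], and the connector decreases in each argument. *)
Lemma conn_le_inv (m p : nat) : conn (S m) p <= / (INR p + 1).
Proof.
  induction m as [|m IH].
  - apply Req_le. unfold conn. change (fact 1) with 1%nat. change (1 + p)%nat with (S p).
    rewrite fact_simpl, mult_INR, (S_INR p), INR_1. field.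
    split; [pose proof (pos_INR p); lra|apply INR_fact_neq_0].
  - eapply Rle_trans; [|exact IH]. rewrite (conn_sym (S (S m))), (conn_sym (S m)).
    apply conn_decr_r.
Qed.

Lemma is_lim_conn (m : nat) : is_lim_seq (conn (S m)) 0.
Proof.
  apply (is_lim_seq_le_le (fun _ => 0) _ (fun p => / (INR p + 1))).
  - intros p. split; [apply Rlt_le, conn_pos|apply conn_le_inv].
  - apply is_lim_seq_const.
  - apply is_lim_seq_inv_shift.
Qed.

(** The difference is the sum of [1 / (p + j)] over [j] from 1 to [m], compared term by term with
    [1 / j]. *)
Lemma harm_sub_bounds (m p : nat) : 0 <= harm (m + p) - harm p <= harm m.
Proof.
  induction m as [|m IH]; [simpl; lra|].
  change (S m + p)%nat with (S (m + p)). rewrite !harm_S.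
  assert (0 < / INR (S (m + p)) <= / INR (S m)); [|lra]. split.
  - apply Rinv_0_lt_compat, INR_S_pos.
  - apply Rinv_le_contravar; [apply INR_S_pos|apply le_INR; lia].
Qed.

Lemma dconn_nonneg (m p : nat) : 0 <= dconn m p.
Proof.
  apply Rmult_le_pos; [apply Rlt_le, conn_pos|apply harm_sub_bounds].
Qed.

Lemma dconn_le (m p : nat) : dconn m p <= conn m p * harm m.
Proof.
  apply Rmult_le_compat_l; [apply Rlt_le, conn_pos|apply harm_sub_bounds].
Qed.

Lemma dconn_0_r (m : nat) : dconn m 0 = harm m.
Proof. unfold dconn. rewrite conn_0_r, Nat.add_0_r. simpl. ring. Qed.

(** Minus the derivative of [conn_sub_r] in [p]; the square comes from differentiating the
    denominator. *)
Lemma dconn_sub_r (m p : nat) :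
  dconn m p - dconn m (S p) =
  INR m * (dconn m (S p) / INR (S p) + conn m (S p) / INR (S p) ^ 2).
Proof.
  unfold dconn. rewrite Nat.add_succ_r, !harm_S, (conn_S_r m p).
  rewrite (S_INR (m + p)), plus_INR, S_INR.
  pose proof (pos_INR m). pose proof (pos_INR p). field. lra.
Qed.

(** Minus the derivative of [conn_sub_l] in [p]; the last term comes from differentiating the factor
    [INR p]. *)
Lemma dconn_sub_l (m p : nat) :
  dconn m p - dconn (S m) p =
  INR p * (dconn (S m) p / INR (S m)) - conn (S m) p / INR (S m).
Proof.
  unfold dconn. change (S m + p)%nat with (S (m + p)). rewrite !harm_S.
  rewrite (conn_sym m p), (conn_S_r p m), (conn_sym (S m) p).
  rewrite (S_INR (m + p)), plus_INR, S_INR.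
  pose proof (pos_INR m). pose proof (pos_INR p). field. lra.
Qed.

Lemma is_lim_dconn_r (m : nat) : is_lim_seq (dconn (S m)) 0.
Proof.
  apply (is_lim_seq_le_le (fun _ => 0) _ (fun p => harm (S m) * conn (S m) p)).
  - intros p. split; [apply dconn_nonneg|]. rewrite Rmult_comm. apply dconn_le.
  - apply is_lim_seq_const.
  - replace (Finite 0) with (Rbar_mult (harm (S m)) 0) by (simpl; f_equal; ring).
    apply is_lim_seq_scal_l, is_lim_conn.
Qed.

(** A crude bound that still makes [harm m / (m + 1)] tend to 0, as [is_lim_dconn_l] requires. *)
Lemma harm_le_sqrt (m : nat) : harm m <= 2 * sqrt (INR m).
Proof.
  induction m as [|m IH]; [simpl; pose proof (sqrt_pos 0); lra|].
  rewrite harm_S.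
  pose proof (pos_INR m) as Hm. pose proof (INR_S_pos m) as HS.
  pose proof (sqrt_sqrt _ Hm). pose proof (sqrt_sqrt _ (Rlt_le _ _ HS)).
  pose proof (sqrt_pos (INR m)). pose proof (sqrt_lt_R0 _ HS).
  rewrite S_INR in *.
  set (x := sqrt (INR m)) in *. set (y := sqrt (INR m + 1)) in *.
  assert (Hy : 1 <= y) by nra.
  replace (INR m + 1) with (y * y).
  assert (/ (y * y) <= / y) by (apply Rinv_le_contravar; nra).
  assert (/ y <= 2 * (y - x)); [|lra].
  assert (Hxy : x <= y) by nra.
  apply (Rmult_le_reg_l y); [lra|]. rewrite Rinv_r by lra. nra.
Qed.

(** Unlike in [is_lim_dconn_r], the harmonic factor now grows with the index, so the decay
    [1 / (m + 1)] of the connector has to beat it. *)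
Lemma is_lim_dconn_l (p : nat) : is_lim_seq (fun m => dconn m (S p)) 0.
Proof.
  apply (is_lim_seq_le_le (fun _ => 0) _ (fun m => 2 * / sqrt (INR m + 1))).
  - intros m. split; [apply dconn_nonneg|].
    eapply Rle_trans; [apply dconn_le|]. rewrite conn_sym.
    pose proof (pos_INR m) as Hm.
    assert (Hs : 0 < sqrt (INR m + 1)) by (apply sqrt_lt_R0; lra).
    pose proof (sqrt_sqrt (INR m + 1) ltac:(lra)) as Hss.
    apply Rle_trans with (/ (INR m + 1) * (2 * sqrt (INR m + 1))).
    + apply Rmult_le_compat; [apply Rlt_le, conn_pos|apply zeta_trunc_nonneg|apply conn_le_inv|].
      eapply Rle_trans; [apply harm_le_sqrt|].
      apply Rmult_le_compat_l; [lra|]. apply sqrt_le_1; lra.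
    + apply Req_le. rewrite <- Hss at 1. field. lra.
  - apply is_lim_seq_const.
  - replace (Finite 0) with (Rbar_mult 2 0) by (simpl; f_equal; ring).
    apply is_lim_seq_scal_l. change (Finite 0) with (Rbar_inv p_infty).
    apply is_lim_seq_inv; [|discriminate].
    apply (filterlim_comp _ _ _ (fun m => INR m + 1) sqrt _ (Rbar_locally p_infty)).
    + apply (is_lim_seq_plus INR (fun _ => 1) p_infty 1 p_infty);
        [apply is_lim_seq_INR|apply is_lim_seq_const|reflexivity].
    + apply filterlim_sqrt_p.
Qed.

(** * Finite sums and the derivative of the elementary symmetric sums *)

Lemma sum_lt_ext (n : nat) (f g : nat -> R) :
  (forall j, (j < n)%nat -> f j = g j) -> sum_lt n f = sum_lt n g.
Proof.
  intros H. induction n as [|n IH]; [reflexivity|].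
  simpl. rewrite IH by (intros; apply H; lia). now rewrite H by lia.
Qed.

Lemma sum_lt_shift (n : nat) (f : nat -> R) :
  sum_lt (S n) f = f 0%nat + sum_lt n (fun j => f (S j)).
Proof.
  induction n as [|n IH]; [simpl; ring|].
  change (sum_lt (S (S n)) f) with (sum_lt (S n) f + f (S n)). rewrite IH. simpl. ring.
Qed.

Lemma sum_lt_plus (n : nat) (f g : nat -> R) :
  sum_lt n (fun j => f j + g j) = sum_lt n f + sum_lt n g.
Proof. induction n as [|n IH]; simpl; [|rewrite IH]; ring. Qed.

Lemma sum_lt_scal (n : nat) (c : R) (f : nat -> R) :
  sum_lt n (fun j => c * f j) = c * sum_lt n f.
Proof. induction n as [|n IH]; simpl; [|rewrite IH]; ring. Qed.

Lemma sum_lt_nonneg (n : nat) (f : nat -> R) :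
  (forall j, 0 <= f j) -> 0 <= sum_lt n f.
Proof.
  intros Hf. induction n as [|n IH]; simpl; [lra|]. specialize (Hf n). lra.
Qed.

Lemma is_series_sum_lt (n : nat) (f : nat -> nat -> R) (s : nat -> R) :
  (forall j, (j < n)%nat -> is_series (f j) (s j)) ->
  is_series (fun i => sum_lt n (fun j => f j i)) (sum_lt n s).
Proof.
  intros H. induction n as [|n IH]; [exact is_series_zero|].
  apply (is_series_plus_R (fun i => sum_lt n (fun j => f j i))); [apply IH|apply H; lia].
  intros j Hj. apply H. lia.
Qed.

(* Minus the derivative at [x = 0] of [esum r i] with every factor [1/p] replaced by [1/(p+x)]. *)
Definition dsum (r i : nat) : R :=
  sum_lt r (fun j => zeta_trunc i (ones j ++ 2%nat :: ones (r - 1 - j))).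

(** The differentiated form of [esum_S]. The summand [j = 0], whose entry 2 comes first, gives the
    square; the others give [dsum r i / INR (S i)]. *)
Lemma dsum_S (r i : nat) :
  dsum (S r) (S i) =
  dsum (S r) i + (dsum r i / INR (S i) + esum r i / INR (S i) ^ 2).
Proof.
  unfold dsum. rewrite !sum_lt_shift.
  replace (S r - 1 - 0)%nat with r by lia.
  change (ones 0 ++ 2%nat :: ones r) with (2%nat :: ones r). rewrite zeta_trunc_S.
  set (h := fun j => zeta_trunc i (ones j ++ 2%nat :: ones (r - 1 - j))).
  set (h1 := fun j => zeta_trunc i (ones (S j) ++ 2%nat :: ones (S r - 1 - S j))).
  rewrite (sum_lt_ext r _ (fun j => h1 j + / INR (S i) * h j)).
  - rewrite sum_lt_plus, sum_lt_scal. unfold Rdiv. ring.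
  - intros j _. unfold h1, h. replace (S r - 1 - S j)%nat with (r - 1 - j)%nat by lia.
    change (ones (S j) ++ 2%nat :: ones (r - 1 - j))
      with (1%nat :: (ones j ++ 2%nat :: ones (r - 1 - j))).
    rewrite zeta_trunc_S, pow_1. reflexivity.
Qed.

Lemma dsum_0_r (r : nat) : dsum r 0 = 0.
Proof.
  unfold dsum. rewrite (sum_lt_ext r _ (fun _ => 0 * 0)).
  - rewrite sum_lt_scal. ring.
  - intros [|j] _; simpl; ring.
Qed.

Lemma dsum_nonneg (r i : nat) : 0 <= dsum r i.
Proof. apply sum_lt_nonneg. intros j. apply zeta_trunc_nonneg. Qed.

(** Lowering the entry 2 to 1 enlarges every term, which brings these sums under the majorant of
    [ex_series_esum]. *)
Lemma zeta_trunc_ones_2_le (j l i : nat) :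
  zeta_trunc i (ones j ++ 2%nat :: ones l) <= esum (S (j + l)) i.
Proof.
  revert i. induction j as [|j IH]; intros i; induction i as [|i IHi]; try (simpl; lra).
  all: rewrite esum_S.
  - change (ones 0 ++ 2%nat :: ones l) with (2%nat :: ones l) in *.
    change (0 + l)%nat with l in *. rewrite zeta_trunc_S.
    pose proof (zeta_trunc_nonneg (ones l) i). pose proof (INR_S_pos i).
    assert (Hx : / INR (S i) ^ 2 <= / INR (S i)).
    { apply Rinv_le_contravar; [assumption|].
      assert (1 <= INR (S i)) by (rewrite S_INR; pose proof (pos_INR i); lra). nra. }
    unfold Rdiv. nra.
  - change (ones (S j) ++ 2%nat :: ones l) with (1%nat :: (ones j ++ 2%nat :: ones l)) in *.
    rewrite zeta_trunc_S, pow_1. specialize (IH i).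
    change (S j + l)%nat with (S (j + l)) in *.
    pose proof (Rinv_0_lt_compat _ (INR_S_pos i)). unfold Rdiv. nra.
Qed.

Lemma is_series_mzv_ones_2 (s j l : nat) : (2 <= s)%nat ->
  is_series (fun i => / INR (S i) ^ s * zeta_trunc i (ones j ++ 2%nat :: ones l))
    (mzv (s :: ones j ++ 2%nat :: ones l)).
Proof.
  intros Hs. apply (is_series_mzv_dominated s (S (j + l))); [assumption|].
  intros i. apply zeta_trunc_ones_2_le.
Qed.

(** * Sums against the connector *)

(** By [conn_sub_r], [conn (S m) (S i) / INR (S i)] is a difference of consecutive values of
    [conn (S m) i / INR (S m)]. Each summation by parts then lowers [r] and releases one factor
    [1 / INR (S m)]. *)
Lemma is_series_conn (r m : nat) :
  is_series (fun i => esum r i * (conn (S m) (S i) / INR (S i))) (/ INR (S m) ^ S r).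
Proof.
  pose proof (INR_S_pos m) as Hm.
  set (f := fun i => / INR (S m) * conn (S m) i).
  assert (Hd : forall i, f i - f (S i) = conn (S m) (S i) / INR (S i)).
  { intros i. unfold f. pose proof (conn_sub_r (S m) i). pose proof (INR_S_pos i).
    rewrite <- Rmult_minus_distr_l, H. field. lra. }
  assert (Hf : forall i, f (S i) <= f i).
  { intros i. apply Rmult_le_compat_l; [apply Rlt_le, Rinv_0_lt_compat, Hm|apply conn_decr_r]. }
  assert (Hlim : is_lim_seq f 0).
  { replace (Finite 0) with (Rbar_mult (/ INR (S m)) 0) by (simpl; f_equal; ring).
    apply is_lim_seq_scal_l, is_lim_conn. }
  induction r as [|r IH].
  - eapply is_series_eq; [apply (abel_esum_0 f Hf Hlim)|intros i; cbv beta; now rewrite Hd|].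
    unfold f. rewrite conn_0_r, pow_1. ring.
  - eapply is_series_eq; [apply (abel_esum_S r f (/ INR (S m) ^ S (S r)) Hf Hlim)
      |intros i; cbv beta; now rewrite Hd|reflexivity].
    eapply is_series_eq; [apply (is_series_scal_R (/ INR (S m)) _ _ IH)| |].
    + intros i. unfold f, Rdiv. ring_R.
    + rewrite <- (tech_pow_Rmult _ (S r)). rewrite Rinv_mult. reflexivity.
Qed.

Lemma is_series_conn_l (r p : nat) :
  is_series (fun i => esum r i * (conn (S i) (S p) / INR (S i))) (/ INR (S p) ^ S r).
Proof.
  eapply is_series_eq; [apply (is_series_conn r p)| |reflexivity].
  intros i. cbv beta. now rewrite conn_sym.
Qed.

(* Differentiating [is_series_conn_l] in [p]. *)
Lemma is_series_dconn_l (r p : nat) :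
  is_series (fun i => esum r i * (dconn (S i) (S p) / INR (S i)))
    (INR (S r) / INR (S p) ^ S (S r)).
Proof.
  pose proof (INR_S_pos p) as Hp.
  (* The differences of [dconn] in its first argument carry an extra
     [- conn (S i) (S p) / INR (S i)] by [dconn_sub_l]; adding [conn / INR (S p)] cancels it by
     [conn_sub_l]. *)
  set (f := fun i => / INR (S p) * (dconn i (S p) + / INR (S p) * conn i (S p))).
  assert (Hd : forall i, f i - f (S i) = dconn (S i) (S p) / INR (S i)).
  { intros i. unfold f. pose proof (conn_sub_l i (S p)) as H1.
    pose proof (dconn_sub_l i (S p)) as H2. pose proof (INR_S_pos i).
    replace (conn i (S p)) with
      (conn (S i) (S p) + INR (S p) * (conn (S i) (S p) / INR (S i))) by lra.
    replace (dconn i (S p)) with (dconn (S i) (S p) +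
      (INR (S p) * (dconn (S i) (S p) / INR (S i)) - conn (S i) (S p) / INR (S i))) by lra.
    field. lra. }
  assert (Hf : forall i, f (S i) <= f i).
  { intros i. assert (0 <= dconn (S i) (S p) / INR (S i)); [|rewrite <- Hd in *; lra].
    apply Rdiv_le_0_compat; [apply dconn_nonneg|apply INR_S_pos]. }
  assert (Hlim : is_lim_seq f 0).
  { replace (Finite 0) with (Rbar_mult (/ INR (S p)) (0 + / INR (S p) * 0))
      by (simpl; f_equal; ring).
    apply is_lim_seq_scal_l, is_lim_seq_plus'; [apply is_lim_dconn_l|].
    apply (is_lim_seq_scal_l _ (/ INR (S p)) 0).
    apply (is_lim_seq_ext (conn (S p))); [intros; apply conn_sym|apply is_lim_conn]. }
  induction r as [|r IH].
  - eapply is_series_eq; [apply (abel_esum_0 f Hf Hlim)|intros i; cbv beta; now rewrite Hd|].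
    unfold f, dconn. rewrite (conn_sym 0), conn_0_r. change (0 + S p)%nat with (S p).
    rewrite INR_1. field. lra.
  - eapply is_series_eq; [apply (abel_esum_S r f (INR (S (S r)) / INR (S p) ^ S (S (S r))) Hf Hlim)
      |intros i; cbv beta; now rewrite Hd|reflexivity].
    (* The two summands of [f] contribute [r + 1] from the induction hypothesis and 1 from
       [is_series_conn_l], which makes the new numerator [r + 2]. *)
    eapply is_series_eq.
    + apply is_series_plus_R;
        [apply (is_series_scal_R (/ INR (S p)) _ _ IH)
        |apply (is_series_scal_R (/ INR (S p) ^ 2) _ _ (is_series_conn_l r p))].
    + intros i. unfold f, Rdiv.
      replace (/ INR (S p) ^ 2) with (/ INR (S p) * / INR (S p)) by (field; lra). ring_R.
    + rewrite (S_INR (S r)), <- !tech_pow_Rmult, ?pow_O. field. split; [apply pow_nonzero|]; lra.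
Qed.

(* The derivative of [is_series_conn] when all summation indices are shifted by [x]. *)
Lemma is_series_dconn (r m : nat) :
  is_series (fun i =>
      esum r i * (dconn (S m) (S i) / INR (S i) + conn (S m) (S i) / INR (S i) ^ 2)
      + dsum r i * (conn (S m) (S i) / INR (S i)))
    (harm (S m) / INR (S m) ^ S r).
Proof.
  pose proof (INR_S_pos m) as Hm.
  set (f := fun i => / INR (S m) * dconn (S m) i).
  set (h := fun i => / INR (S m) * conn (S m) i).
  assert (Hfd : forall i, f i - f (S i) =
     dconn (S m) (S i) / INR (S i) + conn (S m) (S i) / INR (S i) ^ 2).
  { intros i. unfold f. rewrite <- Rmult_minus_distr_l, dconn_sub_r.
    pose proof (INR_S_pos i). field. lra. }
  assert (Hhd : forall i, h i - h (S i) = conn (S m) (S i) / INR (S i)).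
  { intros i. unfold h. rewrite <- Rmult_minus_distr_l, conn_sub_r.
    pose proof (INR_S_pos i). field. lra. }
  assert (Hinv : 0 <= / INR (S m)) by apply Rlt_le, Rinv_0_lt_compat, Hm.
  assert (Hc : forall i, 0 <= conn (S m) (S i)) by (intros; apply Rlt_le, conn_pos).
  assert (Hf : forall i, f (S i) <= f i).
  { intros i. assert (0 <= f i - f (S i)); [|lra]. rewrite Hfd.
    apply Rplus_le_le_0_compat; apply Rdiv_le_0_compat; auto using INR_S_pos, dconn_nonneg.
    apply pow_lt, INR_S_pos. }
  assert (Hh : forall i, h (S i) <= h i).
  { intros i. apply Rmult_le_compat_l, conn_decr_r. assumption. }
  assert (Hflim : is_lim_seq f 0).
  { replace (Finite 0) with (Rbar_mult (/ INR (S m)) 0) by (simpl; f_equal; ring).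
    apply is_lim_seq_scal_l, is_lim_dconn_r. }
  assert (Hhlim : is_lim_seq h 0).
  { replace (Finite 0) with (Rbar_mult (/ INR (S m)) 0) by (simpl; f_equal; ring).
    apply is_lim_seq_scal_l, is_lim_conn. }
  induction r as [|r IH].
  - eapply is_series_eq; [apply (abel_esum_0 f Hf Hflim)| |].
    + intros i. cbv beta. rewrite Hfd. unfold dsum. simpl sum_lt. ring_R.
    + unfold f. rewrite dconn_0_r, pow_1. unfold Rdiv. ring.
  - set (u := fun i => esum r i / INR (S i) * f (S i)).
    set (v := fun i => (dsum r i / INR (S i) + esum r i / INR (S i) ^ 2) * h (S i)).
    assert (Huv : is_series (fun i => u i + v i) (harm (S m) / INR (S m) ^ S (S r))).
    { eapply is_series_eq; [apply (is_series_scal_R (/ INR (S m)) _ _ IH)| |].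
      - intros i. unfold u, v, f, h, Rdiv. ring_R.
      - rewrite <- (tech_pow_Rmult _ (S r)). unfold Rdiv. rewrite Rinv_mult. ring. }
    assert (Hg : forall i, 0 <= dsum r i / INR (S i) + esum r i / INR (S i) ^ 2).
    { intros i. apply Rplus_le_le_0_compat; apply Rdiv_le_0_compat;
        auto using INR_S_pos, dsum_nonneg, zeta_trunc_nonneg. apply pow_lt, INR_S_pos. }
    assert (Hu0 : forall i, 0 <= u i).
    { intros i. apply Rmult_le_pos; [apply esum_div_nonneg|].
      apply Rmult_le_pos; [assumption|apply dconn_nonneg]. }
    assert (Hv0 : forall i, 0 <= v i).
    { intros i. apply Rmult_le_pos; [apply Hg|]. apply Rmult_le_pos; auto. }
    (* Only the sum [u + v] has a known value, while summation by parts needs each series to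
       converge; nonnegativity gives this by comparison. *)
    assert (Hex : ex_series (fun i => u i + v i)) by (eexists; exact Huv).
    destruct (ex_series_le_R u (fun i => u i + v i)) as [s Hs]; [|exact Hex|].
    { intros i. specialize (Hu0 i). specialize (Hv0 i). lra. }
    destruct (ex_series_le_R v (fun i => u i + v i)) as [t Ht]; [|exact Hex|].
    { intros i. specialize (Hu0 i). specialize (Hv0 i). lra. }
    pose proof (is_series_plus_R _ _ _ _ Hs Ht) as Hst.
    apply is_series_unique in Hst. apply is_series_unique in Huv.
    pose proof (abel_esum_S r f s Hf Hflim Hs) as H1.
    pose proof (abel_summation h _ (dsum (S r)) t Hh Hhlim Hg (dsum_S r) Ht) as H2.
    eapply is_series_eq; [exact (is_series_plus_R _ _ _ _ H1 H2)| |].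
    + intros i. cbv beta. now rewrite Hfd, Hhd.
    + rewrite dsum_0_r. etransitivity; [|exact Huv]. etransitivity; [|symmetry; exact Hst]. ring.
Qed.

(** * Duality and evaluation of the double series *)

Lemma mzv_duality (n r : nat) : mzv ((n + 2)%nat :: ones r) = mzv ((r + 2)%nat :: ones n).
Proof.
  apply is_series_mzv.
  (* The connected double series of [esum n i * esum r j * conn (S i) (S j) / ((i + 1) * (j + 1))]
     is symmetric under exchanging [n] and [r], and its two orders of summation give the two
     sides. *)
  eapply is_series_eq;
    [apply (tonelli (fun i j => esum n i / INR (S i) * (esum r j * (conn (S i) (S j) / INR (S j))))
       (fun i => / INR (S i) ^ (r + 2) * esum n i)
       (fun j => / INR (S j) ^ (n + 2) * esum r j) (mzv ((r + 2)%nat :: ones n)))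
    |reflexivity|reflexivity].
  - intros i j. apply Rmult_le_pos; [apply esum_div_nonneg|].
    apply Rmult_le_pos; [apply zeta_trunc_nonneg|].
    apply Rdiv_le_0_compat; [apply Rlt_le, conn_pos|apply INR_S_pos].
  - intros i. eapply is_series_eq;
      [apply (is_series_scal_R (esum n i / INR (S i)) _ _ (is_series_conn r i))|reflexivity|].
    replace (r + 2)%nat with (S (S r)) by lia. rewrite <- (tech_pow_Rmult _ (S r)).
    unfold Rdiv. rewrite Rinv_mult. ring.
  - apply is_series_mzv_ones. lia.
  - intros j. eapply is_series_eq;
      [apply (is_series_scal_R (esum r j / INR (S j)) _ _ (is_series_conn_l n j))| |].
    + intros i. unfold Rdiv. ring_R.
    + replace (n + 2)%nat with (S (S n)) by lia. rewrite <- (tech_pow_Rmult _ (S n)).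
      unfold Rdiv. rewrite Rinv_mult. ring.
Qed.

Lemma is_series_dsum (s r : nat) : (2 <= s)%nat ->
  is_series (fun i => / INR (S i) ^ s * dsum r i)
    (sum_lt r (fun j => mzv (s :: ones j ++ 2%nat :: ones (r - 1 - j)))).
Proof.
  intros Hs. eapply is_series_eq;
    [apply (is_series_sum_lt r
       (fun j i => / INR (S i) ^ s * zeta_trunc i (ones j ++ 2%nat :: ones (r - 1 - j))))
    |intros i; cbv beta; apply sum_lt_scal|reflexivity].
  intros j _. now apply is_series_mzv_ones_2.
Qed.

(** [is_series_dconn] expands the harmonic factor into a series over [j]; the sum over [i] is then
    done first, by [is_series_dconn_l] and [is_series_conn_l]. *)
Lemma is_series_esum_harm (n r : nat) :
  is_series (fun i => esum n i / INR (S i) * (harm (S i) / INR (S i) ^ S r))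
    (sum_lt r (fun j => mzv ((n + 2)%nat :: ones j ++ 2%nat :: ones (r - 1 - j)))
     + INR (n + 2) * mzv ((n + 3)%nat :: ones r)).
Proof.
  apply (tonelli
    (fun j i => esum n i / INR (S i) *
      (esum r j * (dconn (S i) (S j) / INR (S j) + conn (S i) (S j) / INR (S j) ^ 2)
       + dsum r j * (conn (S i) (S j) / INR (S j))))
    (fun j => / INR (S j) ^ (n + 2) * dsum r j
       + INR (n + 2) * (/ INR (S j) ^ (n + 3) * esum r j))).
  - intros j i. pose proof (INR_S_pos j). pose proof (pow_lt _ 2 H).
    pose proof (conn_pos (S i) (S j)). pose proof (dconn_nonneg (S i) (S j)).
    apply Rmult_le_pos; [apply esum_div_nonneg|].
    repeat first [assumption|apply Rlt_le; assumption
                 |apply Rplus_le_le_0_compat|apply Rdiv_le_0_compat|apply Rmult_le_pos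
                 |apply zeta_trunc_nonneg|apply dsum_nonneg].
  - intros j. pose proof (INR_S_pos j).
    eapply is_series_eq.
    (* The coefficient [n + 2] of [esum r j] is [n + 1] from [is_series_dconn_l] plus 1 from the
       squared term. *)
    + apply is_series_plus_R;
        [apply (is_series_scal_R (esum r j / INR (S j)) _ _ (is_series_dconn_l n j))
        |apply (is_series_scal_R (esum r j / INR (S j) ^ 2 + dsum r j / INR (S j)) _ _
                 (is_series_conn_l n j))].
    + intros i. unfold Rdiv. ring_R.
    + replace (n + 2)%nat with (S (S n)) by lia. replace (n + 3)%nat with (S (S (S n))) by lia.
      rewrite (S_INR (S n)), <- !tech_pow_Rmult, ?pow_O. field. split; [apply pow_nonzero|]; lra.
  - apply is_series_plus_R; [apply is_series_dsum; lia|].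
    apply is_series_scal_R, is_series_mzv_ones. lia.
  - intros i. apply is_series_scal_R, is_series_dconn.
Qed.

(* Partial fractions, iterated down to the exponent [1]. *)
Lemma is_series_inv_pow_shift (a m : nat) :
  is_series (fun l => / (INR (S l) ^ S a * (INR (S l) + INR (S m))))
    (sum_lt a (fun r => (-1) ^ r * mzv ((S a - r)%nat :: nil) / INR (S m) ^ S r)
     + (-1) ^ a * (harm (S m) / INR (S m) ^ S a)).
Proof.
  pose proof (INR_S_pos m) as Hm.
  induction a as [|a IH].
  - eapply is_series_eq; [apply (is_series_scal_R (/ INR (S m)) _ _ (is_series_hsum 0 (S m)))| |].
    + intros l. pose proof (INR_S_pos l). cbv beta. change (esum 0 l) with 1. rewrite pow_1.
      eq_R. field. lra.
    + assert (H1 : forall i, hsum 1 i = harm i).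
      { induction i as [|i IHi]; [reflexivity|]. rewrite hsum_S, esum_S, IHi. reflexivity. }
      rewrite H1, pow_1. simpl. unfold Rdiv. ring.
  - eapply is_series_eq.
    + apply is_series_plus_R;
        [apply (is_series_scal_R (/ INR (S m)) _ _ (is_series_mzv_ones (S (S a)) 0 ltac:(lia)))
        |apply (is_series_scal_R (- / INR (S m)) _ _ IH)].
    + intros l. pose proof (INR_S_pos l). cbv beta. change (esum 0 l) with 1.
      rewrite <- (tech_pow_Rmult _ (S a)).
      assert (INR (S l) ^ S a <> 0) by (apply pow_nonzero; lra).
      eq_R. field. lra.
    (* The zeta value split off by this partial fraction is the summand [r = 0]; the induction
       hypothesis supplies the others, shifted by one and with opposite sign. *)
    + rewrite sum_lt_shift. change (S (S a) - 0)%nat with (S (S a)).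
      rewrite (sum_lt_ext a (fun r => (-1) ^ S r * mzv ((S (S a) - S r)%nat :: nil) / INR (S m) ^ S (S r))
         (fun r => - / INR (S m) * ((-1) ^ r * mzv ((S a - r)%nat :: nil) / INR (S m) ^ S r))).
      * rewrite sum_lt_scal. rewrite <- !(tech_pow_Rmult _ (S a)). rewrite <- (tech_pow_Rmult (-1) a).
        change (ones 0) with (@nil nat).
        rewrite pow_O, pow_1. unfold Rdiv. rewrite Rinv_mult. ring.
      * intros r _. change (S (S a) - S r)%nat with (S a - r)%nat.
        rewrite <- (tech_pow_Rmult _ (S r)). rewrite <- (tech_pow_Rmult (-1) r).
        unfold Rdiv. rewrite Rinv_mult. ring.
Qed.

Theorem theorem2p8 (k n : nat) (hk : (1 <= k)%nat) (hn : (1 <= n)%nat) :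
  mzsv ((k + 1)%nat :: ones n) =
    (-1) ^ (k - 1) *
      (sum_lt (k - 1) (fun j => mzv ((n + 1)%nat :: ones j ++ 2%nat :: ones (k - 2 - j)))
       + INR (n + 1) * mzv ((n + 2)%nat :: ones (k - 1)))
    + sum_lt (k - 1) (fun r => (-1) ^ r * mzv (cons (k - r)%nat nil)
                                       * mzv ((n + 1)%nat :: ones r)).
Proof.
  (* From here [a] is [k - 1] and [n] is one less than in the statement, which fits the exponents
     [n + 2] and [r + 2] of [mzv_duality]. *)
  destruct k as [|a]; [lia|]. destruct n as [|n]; [lia|].
  replace (S a - 1)%nat with a by lia. replace (S n + 1)%nat with (n + 2)%nat by lia.
  replace (S n + 2)%nat with (n + 3)%nat by lia.
  set (B := sum_lt a (fun j => mzv ((n + 2)%nat :: ones j ++ 2%nat :: ones (a - 1 - j)))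
     + INR (n + 2) * mzv ((n + 3)%nat :: ones a)).
  rewrite (sum_lt_ext a _ (fun j => mzv ((n + 2)%nat :: ones j ++ 2%nat :: ones (a - 1 - j))))
    by (intros j _; replace (S a - 2 - j)%nat with (a - 1 - j)%nat by lia; reflexivity).
  fold B.
  (* Duality puts the products in the form that partial fractions produce, with the depth governed
     by [n] and the exponent by [r]. *)
  rewrite (sum_lt_ext a (fun r => (-1) ^ r * mzv ((S a - r)%nat :: nil) * mzv ((n + 2)%nat :: ones r))
     (fun r => (-1) ^ r * mzv ((S a - r)%nat :: nil) * mzv ((r + 2)%nat :: ones n)))
    by (intros r _; now rewrite mzv_duality).
  apply is_series_mzsv.
  (* The row sums are written with alternating signs, but the terms of the double series are
     positive or zero, so the interchange takes place before any splitting. *)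
  apply (tonelli
    (fun m l => esum n m / INR (S m) * / (INR (S l) ^ S a * (INR (S l) + INR (S m))))
    (fun m => esum n m / INR (S m) *
      (sum_lt a (fun r => (-1) ^ r * mzv ((S a - r)%nat :: nil) / INR (S m) ^ S r)
       + (-1) ^ a * (harm (S m) / INR (S m) ^ S a)))).
  - intros m l. pose proof (INR_S_pos m). pose proof (INR_S_pos l).
    apply Rmult_le_pos; [apply esum_div_nonneg|].
    apply Rlt_le, Rinv_0_lt_compat, Rmult_lt_0_compat; [apply pow_lt|]; lra.
  - intros m. apply is_series_scal_R, is_series_inv_pow_shift.
  - eapply is_series_eq.
    + apply is_series_plus_R; [apply (is_series_scal_R ((-1) ^ a) _ _ (is_series_esum_harm n a))|].
      apply (is_series_sum_lt a (fun r i => (-1) ^ r * mzv ((S a - r)%nat :: nil) *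
         (/ INR (S i) ^ (r + 2) * esum n i))).
      intros r _. apply is_series_scal_R, is_series_mzv_ones. lia.
    + intros i. cbv beta. rewrite Rmult_plus_distr_l, <- sum_lt_scal.
      rewrite Rplus_comm. f_equal; [apply sum_lt_ext|ring].
      intros r _. replace (r + 2)%nat with (S (S r)) by lia.
      rewrite <- (tech_pow_Rmult _ (S r)). unfold Rdiv. rewrite Rinv_mult. ring.
    + reflexivity.
  - intros l. pose proof (INR_S_pos l).
    (* For fixed [l], the identity [(1 / m - 1 / (l + m)) / l = 1 / (m * (l + m))] uses one of the
       [a + 2] factors [1 / l] of the star sum. *)
    eapply is_series_eq;
      [apply (is_series_scal_R (/ INR (S l) ^ (S a + 1)) _ _ (is_series_hsum n (S l)))| |reflexivity].
    intros m. pose proof (INR_S_pos m). replace (S a + 1)%nat with (S (S a)) by lia.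
    rewrite <- (tech_pow_Rmult _ (S a)).
    assert (INR (S l) ^ S a <> 0) by (apply pow_nonzero; lra).
    eq_R. field. lra.
Qed.
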